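(* Let $p$ be a prime, let $R$ be a finite ring such that $p$ is the smallest prime dividing $|R|$, and let $S$ be a subring of $R$. 1. If $S\nsubseteq Z(R)$ and $S$ is commutative, then $\Pr(S,R)\le \dfrac{2p-1}{p^2}$. 2. If $S\nsubseteq Z(R)$ and $S$ is non-commutative, then $\Pr(S,R)\le \dfrac{p^2+p-1}{p^3}$.
   Context: Rings are associative and are not required to have an identity; a subring is an additive subgroup closed under multiplication. $Z(R)$ is the center of $R$. For a subring $S$ of a finite ring $R$, $\Pr(S,R)=\dfrac{|\{(s,r)\in S\times R: sr=rs\}|}{|S|\,|R|}$. *)

(* Defs.v *)
From HB Require Import structures.
From mathcomp Require Import all_boot all_order all_algebra.

Set Implicit Arguments.
Unset Strict Implicit.
Unset Printing Implicit Defensive.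

Import Order.TTheory GRing.Theory Num.Theory.
Local Open Scope ring_scope.

(* Associative rings, not assumed to have an identity.  MathComp's own rings
   (pzRingType and its extensions) are all unital, so the structure is built
   directly on top of zmodType. *)
HB.mixin Record Zmodule_isRng R of GRing.Zmodule R := {
  rmul : R -> R -> R;
  rmulA : associative rmul;
  rmulDl : left_distributive rmul +%R;
  rmulDr : right_distributive rmul +%R
}.

#[short(type="rngType")]
HB.structure Definition Rng := {R of Zmodule_isRng R & GRing.Zmodule R}.

#[short(type="finRngType")]
HB.structure Definition FinRng := {R of Rng R & Finite R}.

(* A subring need not contain an identity, even when R has one. *)
Definition is_subring (R : finRngType) (S : {set R}) : Prop :=
  zmod_closed S /\ {in S &, forall x y, rmul x y \in S}.

Definition rng_center (R : finRngType) : {set R} :=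
  [set x | [forall y, rmul x y == rmul y x]].

Definition commutative_on (R : finRngType) (S : {set R}) : Prop :=
  {in S &, commutative (@rmul R)}.

(* The relative commuting probability Pr(S, R); the ambient ring R is
   determined by the type of S. *)
Definition Pr (R : finRngType) (S : {set R}) : rat :=
  #|[set u in setX S [set: R] | rmul u.1 u.2 == rmul u.2 u.1]|%:R
    / (#|S|%:R * #|R|%:R).

(* Main.v *)
Require Import Defs.
From mathcomp Require Import all_boot all_order all_fingroup all_algebra.

Import Order.TTheory GRing.Theory Num.Theory.
Local Open Scope ring_scope.

(** Counting the commuting pairs by their first entry gives
    [Pr S = (1 / #|S|) * \sum_(x in S) #|C(x)| / #|R|], where [C(x)] is the
    centralizer of [x] in [R].  For [x] in the center of [R] the ratio
    [#|C(x)| / #|R|] is 1; for every other [x], [C(x)] is a proper additive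
    subgroup of [R], so the ratio is at most [1 / p], because the index of a
    proper subgroup has a prime factor and that prime divides [#|R|].  If the
    central elements of [S] make up at most [1 / m] of [S], it follows that
    [Pr S <= 1 / m + (1 - 1 / m) / p = (m + p - 1) / (p * m)]
    ([Pr_le_of_card_central]).

    When [S] is not central, its central part is a proper subgroup and [m = p]
    is admissible.  When [S] contains a non-commuting pair [x], [y], there is a
    chain of two proper inclusions, from the central part of [S] to the
    centralizer of [x] in [S] (which contains the non-central [x]) and from
    there to [S] (which contains [y]); each step has index at least [p], so
    [m = p ^ 2] is admissible. *)

(** * Additive subgroups of a finite abelian group *)

Lemma zmod_closed_group_set (V : finZmodType) (A : {set V}) :
  zmod_closed A -> group_set A.
Proof.
move=> [A0 AB]; apply/group_setP; split=> // x y Ax Ay.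
rewrite FinRing.zmodMgE -[y]opprK; apply: (AB) => //.
by rewrite -[- y]sub0r; apply: AB.
Qed.

Lemma zmod_closedI (V : finZmodType) (A B : {set V}) :
  zmod_closed A -> zmod_closed B -> zmod_closed (A :&: B).
Proof.
move=> [A0 AB] [B0 BB]; split=> [|x y]; first by rewrite inE A0 B0.
by rewrite !inE => /andP[Ax Bx] /andP[Ay By]; rewrite AB ?BB.
Qed.

(** By Lagrange's theorem the index of [A] in [B] divides [#|V|], so its least
    prime factor is at least [p]. *)
Lemma leq_mul_card_proper_zmod (p : nat) (V : finZmodType) (A B : {set V}) :
    (forall q : nat, prime q -> (q %| #|V|)%N -> (p <= q)%N) ->
    zmod_closed A -> zmod_closed B -> A \proper B ->
  (p * #|A| <= #|B|)%N.
Proof.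
move=> p_min /zmod_closed_group_set gA /zmod_closed_group_set gB ltAB.
pose G := Group gA; pose H := Group gB.
have sGH : G \subset H := proper_sub ltAB.
have index_gt1 : (1 < #|H : G|%g)%N by rewrite indexg_gt1 (proper_subn ltAB).
have index_dvd : (#|H : G|%g %| #|V|)%N.
  by rewrite (dvdn_trans (dvdn_indexg H G)) // -cardsT (cardSg (subsetT H)).
have le_p_index : (p <= #|H : G|%g)%N.
  apply: leq_trans (pdiv_leq (ltnW index_gt1)).
  by apply: p_min; rewrite ?pdiv_prime // (dvdn_trans (pdiv_dvd _)).
by rewrite -[#|B|](Lagrange sGH) mulnC leq_mul2l le_p_index orbT.
Qed.

(** * Centralizers *)

Definition rng_cent (R : finRngType) (x : R) : {set R} :=
  [set y | rmul x y == rmul y x].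
Arguments rng_cent {R} x.

Lemma rmul0r (R : finRngType) (x : R) : rmul 0 x = 0.
Proof. by apply: (addrI (rmul 0 x)); rewrite -rmulDl !addr0. Qed.

Lemma rmulr0 (R : finRngType) (x : R) : rmul x 0 = 0.
Proof. by apply: (addrI (rmul x 0)); rewrite -rmulDr !addr0. Qed.

Lemma rmulBl (R : finRngType) (x y z : R) :
  rmul (x - y) z = rmul x z - rmul y z.
Proof. by apply: (addIr (rmul y z)); rewrite -rmulDl !subrK. Qed.

Lemma rmulBr (R : finRngType) (x y z : R) :
  rmul x (y - z) = rmul x y - rmul x z.
Proof. by apply: (addIr (rmul x z)); rewrite -rmulDr !subrK. Qed.

Lemma rng_cent_zmod_closed (R : finRngType) (x : R) :
  zmod_closed (rng_cent x).
Proof.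
split=> [|y z]; rewrite !inE ?rmul0r ?rmulr0 // => /eqP xy /eqP xz.
by rewrite rmulBl rmulBr xy xz.
Qed.

Lemma rng_cent_sym (R : finRngType) (x y : R) :
  (x \in rng_cent y) = (y \in rng_cent x).
Proof. by rewrite !inE eq_sym. Qed.

Lemma rng_centerP (R : finRngType) (x : R) :
  reflect (forall y, y \in rng_cent x) (x \in rng_center R).
Proof.
by rewrite inE; apply: (iffP forallP) => cx y; move: (cx y); rewrite inE.
Qed.

Lemma rng_center_zmod_closed (R : finRngType) : zmod_closed (rng_center R).
Proof.
split=> [|x y /rng_centerP cx /rng_centerP cy]; apply/rng_centerP=> z;
  rewrite rng_cent_sym; have [z0 zB] := rng_cent_zmod_closed R z => //.
by apply: zB; rewrite rng_cent_sym.
Qed.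

Lemma rng_cent_central (R : finRngType) (x : R) :
  x \in rng_center R -> rng_cent x = [set: R].
Proof. by move/rng_centerP=> cx; apply/setP=> y; rewrite cx inE. Qed.

Lemma rng_cent_proper (R : finRngType) (x : R) :
  x \notin rng_center R -> rng_cent x \proper [set: R].
Proof.
apply: contraR; rewrite properT negbK => /eqP cx.
by apply/rng_centerP=> y; rewrite cx inE.
Qed.

(** * Counting commuting pairs *)

Lemma card_commuting_pairs (R : finRngType) (S : {set R}) :
  #|[set u in setX S [set: R] | rmul u.1 u.2 == rmul u.2 u.1]|
    = (\sum_(x in S) #|rng_cent x|)%N.
Proof.
under eq_bigr => x _ do rewrite -sum1_card.
rewrite pair_big_dep /= -sum1_card; apply: eq_bigl => -[x y].
by rewrite !inE /= andbT.
Qed.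

(** The term [#|S :&: rng_center R| * #|R|] stands on the left so that no
    truncated subtraction occurs. *)
Lemma leq_card_commuting_pairs (p : nat) (R : finRngType) (S : {set R}) :
    (forall q : nat, prime q -> (q %| #|R|)%N -> (p <= q)%N) ->
  (p * (\sum_(x in S) #|rng_cent x|) + #|S :&: rng_center R| * #|R|
     <= (p * #|S :&: rng_center R| + #|S|) * #|R|)%N.
Proof.
move=> p_min; rewrite (big_setID (rng_center R)) /=.
have -> : (\sum_(x in S :&: rng_center R) #|rng_cent x|
            = #|S :&: rng_center R| * #|R|)%N.
  rewrite -sum_nat_const; apply: eq_bigr => x /setIP[_ cx].
  by rewrite rng_cent_central // cardsT.
have : (p * (\sum_(x in S :\: rng_center R) #|rng_cent x|)
         <= #|S :\: rng_center R| * #|R|)%N.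
  rewrite big_distrr -sum_nat_const; apply: leq_sum => x /setDP[_ ncx].
  rewrite -[leqRHS]cardsT; apply: leq_mul_card_proper_zmod => //.
  - exact: rng_cent_zmod_closed.
  - by split=> [|y z _ _]; rewrite inE.
  - exact: rng_cent_proper.
rewrite -(cardsID (rng_center R) S) !mulnDl !mulnDr !mulnA => le_noncentral.
by rewrite -!addnA leq_add2l addnC leq_add2l.
Qed.

Lemma Pr_le_of_card_central (p m : nat) (R : finRngType) (S : {set R}) :
    (0 < p)%N -> (0 < m)%N ->
    (forall q : nat, prime q -> (q %| #|R|)%N -> (p <= q)%N) ->
    0 \in S -> (m * #|S :&: rng_center R| <= #|S|)%N ->
  Pr S <= (m%:R + p%:R - 1) / (p%:R * m%:R).
Proof.
move=> p_gt0 m_gt0 p_min S0 le_central; rewrite /Pr card_commuting_pairs.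
have := leq_card_commuting_pairs p R S p_min.
have S_gt0 : (0 < #|S|)%N by apply/card_gt0P; exists 0.
have R_gt0 : (0 < #|R|)%N by apply/card_gt0P; exists 0.
move: (\sum_(_ in _) _)%N #|S :&: _| #|S| #|R| S_gt0 R_gt0 le_central.
move=> N z s r s_gt0 r_gt0 le_mz.
case: p p_gt0 {p_min} => // p _ le_N.
have {}le_N : (p.+1 * N <= (p * z + s) * r)%N.
  by rewrite -(leq_add2r (z * r)) -mulnDl addnAC -mulSnr.
rewrite ler_pdivrMr ?mulr_gt0 ?ltr0n //.
rewrite mulrAC ler_pdivlMr ?mulr_gt0 ?ltr0n //.
have -> : m%:R + p.+1%:R - 1 = (m + p)%:R :> rat.
  by rewrite -natr1 natrD addrA addrK.
rewrite -!natrM ler_nat.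
apply: (@leq_trans (m * ((p * z + s) * r))%N).
  by rewrite mulnA mulnC (mulnC N) leq_mul2l le_N orbT.
rewrite !mulnA leq_mul2r mulnDr [leqRHS]mulnDl addnC leq_add2l.
by rewrite mulnCA leq_mul2l le_mz !orbT.
Qed.

Theorem theorem2p7 (p : nat) (R : finRngType) (S : {set R})
    (p_pr : prime p)
    (p_dvd : (p %| #|R|)%N)
    (p_min : forall q : nat, prime q -> (q %| #|R|)%N -> (p <= q)%N)
    (S_subring : is_subring S) :
  (~~ (S \subset rng_center R) -> commutative_on S ->
     Pr S <= (2%:R * p%:R - 1) / p%:R ^+ 2) /\
  (~~ (S \subset rng_center R) -> ~ commutative_on S ->
     Pr S <= (p%:R ^+ 2 + p%:R - 1) / p%:R ^+ 3).
Proof.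
have p_gt0 := prime_gt0 p_pr.
have [S_zmod _] := S_subring; have [S0 _] := S_zmod.
have central_zmod := zmod_closedI _ _ _ S_zmod (rng_center_zmod_closed R).
split=> [S_noncentral _ | _ S_noncomm].
  rewrite mulr_natl mulr2n expr2; apply: Pr_le_of_card_central => //.
  apply: leq_mul_card_proper_zmod => //.
  by rewrite properE subsetIl subsetI subxx.
have [x Sx [y Sy ncxy]] :
    exists2 x, x \in S & exists2 y, y \in S & y \notin rng_cent x.
  case: (boolP [exists x in S, exists y in S, y \notin rng_cent x]).
    by case/exists_inP=> x Sx /exists_inP[y Sy ncxy]; exists x => //; exists y.
  move=> comm; case: S_noncomm => x y Sx Sy; apply/eqP.
  apply: contraNT comm => ncxy; apply/exists_inP; exists x => //.
  by apply/exists_inP; exists y; rewrite ?inE.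
have cent_zmod := zmod_closedI _ _ _ S_zmod (rng_cent_zmod_closed R x).
have lt_central_cent : S :&: rng_center R \proper S :&: rng_cent x.
  apply/properP; split.
    apply: setIS; apply/subsetP=> z /rng_centerP cz.
    by rewrite rng_cent_sym.
  exists x; first by rewrite !inE Sx eqxx.
  by rewrite inE Sx; apply: contra ncxy => /rng_centerP.
have lt_cent_S : S :&: rng_cent x \proper S.
  apply/properP; split; first exact: subsetIl.
  by exists y; rewrite // in_setI Sy.
rewrite (exprS _ 2) -natrX; apply: Pr_le_of_card_central; rewrite ?expn_gt0 ?p_gt0 //.
rewrite -mulnn -mulnA.
apply: leq_trans
  (leq_mul_card_proper_zmod _ _ _ _ p_min cent_zmod S_zmod lt_cent_S).
by rewrite leq_mul2l leq_mul_card_proper_zmod ?orbT.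
Qed.
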